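(* For nonnegative integers $n$ and $\alpha$, $$\sum_{k=0}^n \binom{k+\alpha}{\alpha} |\mathcal{T}_{n,k}| = (n+1+\alpha)^n.$$
   Context: $\mathcal{T}_n$ is the set of rooted labeled trees on vertex set $[0,n]=\{0,\dots,n\}$. For $T\in\mathcal{T}_n$, the maximal decreasing subtree $\mathrm{MD}(T)$ is the subtree induced by the root and all vertices $v$ such that labels strictly decrease along the path from the root to $v$. $\mathcal{T}_{n,k}$ is the set of $T\in\mathcal{T}_n$ whose $\mathrm{MD}(T)$ has exactly $k+1$ vertices. Convention $0^0=1$. *)

(* Defs.v *)
From mathcomp Require Import all_boot.

Set Implicit Arguments.
Unset Strict Implicit.
Unset Printing Implicit Defensive.

(* A simple graph on the finite vertex type V is given by its set E of edges,
   each edge being a two-element set of vertices. *)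
Section Graphs.

Variable V : finType.
Implicit Types (E : {set {set V}}) (r v x y : V) (c p : seq V).

Definition simple_graph E : bool := [forall e in E, #|e| == 2].

Definition adj E : rel V := [rel x y | [set x; y] \in E].

Definition connected E : bool := [forall x, forall y, connect (adj E) x y].

(* Cycles visit pairwise distinct vertices, so bounding their length by #|V|
   loses nothing (see acyclicP); the bound only serves to make the predicate
   boolean. *)
Definition acyclic E : bool :=
  [forall m : 'I_#|V|.+1, forall c : m.-tuple V,
     (2 < size c) ==> ~~ ucycleb (adj E) c].

Definition is_tree E : bool := [&& simple_graph E, connected E & acyclic E].

Lemma acyclicP E :
  reflect (forall c, ucycle (adj E) c -> size c <= 2) (acyclic E).
Proof.
apply: (iffP forallP) => [acE c /andP[cE cU] | acE m].
  have sz_c : size c < #|V|.+1 by rewrite ltnS -(card_uniqP cU) max_card.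
  have /forallP/(_ (in_tuple c))/implyP := acE (Ordinal sz_c).
  move=> nc; rewrite leqNgt; apply/negP => lt2c.
  by move/negP: (nc lt2c); apply; rewrite /ucycleb cE.
apply/forallP => c; apply/implyP; rewrite ltnNge => /negP szc.
by apply/negP => /acE.
Qed.

End Graphs.

(* The pair (E, r) is the tree with edge set E, rooted at r. *)
Definition rooted_graph (n : nat) : finType :=
  ({set {set 'I_n.+1}} * 'I_n.+1)%type.

Definition rooted_trees (n : nat) : {set rooted_graph n} :=
  [set T | is_tree T.1].

Definition decr_adj (n : nat) (E : {set {set 'I_n.+1}}) : rel 'I_n.+1 :=
  [rel x y | adj E x y && (y < x)].

(* The vertex set of MD(T).  A walk with strictly decreasing labels has no
   repeated vertex, so in a tree it is the path from the root (see MDP). *)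
Definition MD (n : nat) (T : rooted_graph n) : {set 'I_n.+1} :=
  [set v | connect (decr_adj T.1) T.2 v].

Definition rooted_trees_MD (n k : nat) : {set rooted_graph n} :=
  [set T in rooted_trees n | #|MD T| == k.+1].

Lemma MDP (n : nat) (T : rooted_graph n) (v : 'I_n.+1) :
  reflect (exists p : seq 'I_n.+1,
             [/\ path (adj T.1) T.2 p, uniq (T.2 :: p), last T.2 p = v
               & sorted (fun x y : 'I_n.+1 => y < x) (T.2 :: p)])
          (v \in MD T).
Proof.
have splitE x p : path (decr_adj T.1) x p
    = path (adj T.1) x p && path (fun x y : 'I_n.+1 => y < x) x p.
  by elim: p x => //= y p IHp x; rewrite IHp andbACA.
rewrite inE; apply: (iffP connectP) => [[p] | [p [pE _ <- pD]]].
  rewrite splitE => /andP[pE pD] ->; exists p; split=> //.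
  apply: (@sorted_uniq _ (fun x y : 'I_n.+1 => y < x)) => // [y x z yx zy | x].
    exact: ltn_trans zy yx.
  exact: ltnn.
by exists p; rewrite // splitE pE.
Qed.

(* Main.v *)
Require Import Defs.
From mathcomp Require Import all_boot.

Set Implicit Arguments.
Unset Strict Implicit.
Unset Printing Implicit Defensive.

(** Rooted trees are encoded by parent functions with one root.  For a set [S] of
    vertices and a parameter [b], sum [b ^ (#roots - 1)] over the rooted forests
    in which [S] is the set of vertices whose labels increase all the way up to
    their root.  On [S] the parents are chosen independently: each vertex takes a
    larger element of [S] or becomes a root (the largest element must), so the sum
    is [(b+1)...(b+k) = k! 'C(k + b, b)], with [#|S| = k + 1], times a factor that
    does not depend on [b].  Comparing [b = 0], which selects trees, with
    [b = alpha] turns the left-hand side into the sum of [alpha ^ (#roots - 1)]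
    over all rooted forests on [n + 1] vertices.  Cutting forests into layers
    gives [r d ^ (d - r - 1)] forests on [d] vertices with [r] given roots, and
    the binomial theorem concludes. *)

(** * Rooted forests as parent functions, and their enumeration *)

Section ParentFunctions.

Variable V : finType.
Implicit Types (f g : {ffun V -> option V}) (A B D Y : {set V}).

Definition parent_rel f : rel V := [rel v w | f v == Some w].

Definition forest f : bool :=
  [forall v, forall w, (f v == Some w) ==> ~~ connect (parent_rel f) w v].

Definition root_set f : {set V} := [set v | f v == None].

Definition rank f (h : V -> nat) : Prop := forall v w, f v = Some w -> h w < h v.

(** The number of vertices reachable from [v] is a rank, since in a forest the parent of [v] no
    longer reaches [v]. Ranks serve below as induction measures along parents. *)
Lemma forestP f : reflect (exists h, rank f h) (forest f).
Proof.
apply: (iffP forallP) => [ff | [h hP] v].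
  exists (fun v => #|[set u | connect (parent_rel f) v u]|) => v w fvw.
  have nwv : ~~ connect (parent_rel f) w v.
    by have /forallP/(_ w)/implyP := ff v; apply; apply/eqP.
  apply: proper_card; apply/properP; split; last by exists v; rewrite inE.
  apply/subsetP=> u; rewrite !inE; apply: connect_trans.
  by apply: connect1; apply/eqP.
apply/forallP=> w; apply/implyP => /eqP /hP lt_wv.
apply/negP => /connectP[p pP def_v].
have: h v <= h w.
  rewrite def_v; elim: p w pP {lt_wv def_v} => //= u p IHp w /andP[/eqP fwu pP].
  exact: leq_trans (IHp _ pP) (ltnW (hP _ _ fwu)).
by rewrite leqNgt lt_wv.
Qed.

Lemma root_set_gt0 f (v : V) : forest f -> 0 < #|root_set f|.
Proof.
case/forestP => h hP; have [m ltm] := ubnP (h v).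
elim: m v ltm => // m IHm v ltm.
case fv: (f v) => [w|]; last by apply/card_gt0P; exists v; rewrite inE fv.
by apply: (IHm w); rewrite -ltnS; apply: leq_trans ltm; rewrite ltnS hP.
Qed.

Definition clear A f : {ffun V -> option V} :=
  [ffun v => if v \in A then None else f v].

(** A function [f] amounts to [clear A f] together with free values on [A]. As [Q] sees only the
    former and the weight only the latter, the sum factors; the fixed points of [clear A] are the
    possible outer parts. *)
Lemma split_sum A (Q : pred {ffun V -> option V}) (w : V -> option V -> nat) :
  \sum_(f | Q (clear A f)) \prod_(v in A) w v (f v)
  = #|[set g | Q g && (clear A g == g)]| * \prod_(v in A) \sum_x w v x.
Proof.
have clearK f : clear A (clear A f) == clear A f.
  by apply/eqP/ffunP=> v; rewrite !ffunE; case: (v \in A).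
rewrite (partition_big (clear A) [pred g | Q g && (clear A g == g)]) /=; last first.
  by move=> f Qf; rewrite Qf clearK.
rewrite -sum_nat_const [RHS](eq_bigl [pred g | Q g && (clear A g == g)]);
  last by move=> g; rewrite inE.
apply: eq_bigr => g /andP[Qg /eqP cg].
pose W v x := if v \in A then w v x else (x == g v : nat).
(* The weight [W] forces [f v = g v] off [A], so the sum can run over all functions and
   distributivity applies. *)
transitivity (\sum_(f : {ffun V -> option V}) \prod_v W v (f v)); last first.
  rewrite -(bigA_distr_bigA W) (bigID (mem A)) /= [X in _ * X]big1 ?muln1.
    by apply: eq_bigr => v vA; apply: eq_bigr => x _; rewrite /W vA.
  move=> v /negPf vA; rewrite /W vA (bigD1 (g v)) //= eqxx big1 ?addn0 // => x.
  by move/negPf->.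
rewrite [RHS](bigID (fun f : {ffun V -> option V} => Q (clear A f) && (clear A f == g))) /=.
rewrite [X in _ = _ + X]big1 ?addn0.
  apply: eq_bigr => f /andP[_ /eqP cf].
  rewrite [RHS](bigID (mem A)) /= [X in _ = _ * X]big1 ?muln1 => [|v vA].
    by apply: eq_bigr => v vA; rewrite /W vA.
  rewrite /W (negPf vA) -cf ffunE (negPf vA) eqxx //.
move=> f ncf.
have [v]: exists v, clear A f v != g v.
  apply/existsP; rewrite -negb_forall; apply: contraNN ncf => /forallP fg.
  have -> : clear A f = g by apply/ffunP => v; apply/eqP.
  by rewrite Qg eqxx.
rewrite (bigD1 v) //= -{1}cg !ffunE /W; case: ifP => [_|_ /negPf->] //.
Qed.

Lemma sum_option (F : option V -> nat) : \sum_x F x = F None + \sum_v F (Some v).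
Proof.
rewrite (bigD1 None) //= (reindex_omap Some id) /=; last by case.
by congr (_ + _); apply: eq_bigl => v; rewrite eqxx.
Qed.

Lemma sum_subsets D (F : nat -> nat) :
  \sum_(Y : {set V} | Y \subset D) F #|Y| = \sum_(i < #|D|.+1) 'C(#|D|, i) * F i.
Proof.
rewrite (partition_big (fun Y : {set V} => inord #|Y| : 'I_#|D|.+1) xpredT) //=.
apply: eq_bigr => i _.
rewrite (eq_bigr (fun=> F i)); last first.
  move=> Y /andP[YD /eqP <-]; rewrite inordK // ltnS subset_leq_card //.
rewrite sum_nat_const; congr (_ * _); rewrite -(cards_draws D i).
apply: eq_card => Y; rewrite inE unfold_in.
case YD: (Y \subset D) => //=.
by rewrite -val_eqE /= inordK // ltnS subset_leq_card.
Qed.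

(** With [d = #|D|], grouping by size and absorbing, [i 'C(d, i) = d 'C(d - 1, i - 1)], leaves the
    binomial expansion of [(x + d) ^ (d - 1)]. *)
Lemma sum_subsets_binomial D (x : nat) : 0 < #|D| ->
  \sum_(Y : {set V} | Y \subset D) #|Y| * x ^ #|Y|.-1 * #|D| ^ (#|D| - #|Y|)
  = #|D| * (x + #|D|) ^ #|D|.-1.
Proof.
rewrite (sum_subsets D (fun i => i * x ^ i.-1 * #|D| ^ (#|D| - i))).
case: #|D| => // d _.
rewrite big_ord_recl !mul0n muln0 add0n addnC expnDn big_distrr /=.
apply: eq_bigr => i _; rewrite /bump add1n subSS !mulnA /=.
by rewrite [in LHS](mulnC 'C(_, _)) mul_bin_diag -!mulnA [x ^ i * _]mulnC.
Qed.

(* Forests on [D] with root set [B]; the value [None] is also given off [D]. *)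
Definition forests_on D B : {set {ffun V -> option V}} :=
  [set f | forest f && [forall v, if f v is Some w then (v \in D :\: B) && (w \in D)
                                  else v \notin D :\: B]].

Lemma forests_onP D B f :
  reflect (forest f /\ forall v, if f v is Some w then (v \in D :\: B) && (w \in D)
                                  else v \notin D :\: B)
          (f \in forests_on D B).
Proof. by rewrite inE; apply: (iffP andP) => -[ff /forallP]. Qed.

(* The layer [Y] consists of the children of [B]. *)
Lemma forests_on_rec D B : B \subset D ->
  #|forests_on D B|
  = \sum_(Y : {set V} | Y \subset D :\: B) #|B| ^ #|Y| * #|forests_on (D :\: B) Y|.
Proof.
move=> BD; rewrite -sum1_card.
pose kids f := [set v | if f v is Some w then w \in B else false].
rewrite (partition_big kids (fun Y => Y \subset D :\: B)) /=; last first.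
  move=> f /forests_onP[_ fP]; apply/subsetP => v; rewrite inE.
  by have := fP v; case: (f v) => // w /andP[].
apply: eq_bigr => Y /subsetP YD.
(* Once [Y] is fixed, its vertices choose their parents in [B] independently, and the other parents
   form a forest on [D :\: B] with root set [Y]. *)
pose w (_ : V) (x : option V) : nat := if x is Some u then u \in B else false.
have sumw v : \sum_x w v x = #|B|.
  by rewrite sum_option add0n /= -sum1_card [RHS]big_mkcond; apply: eq_bigr => u _; case: ifP.
transitivity (\sum_(f | clear Y f \in forests_on (D :\: B) Y)
                \prod_(v in Y) w v (f v)); last first.
  rewrite split_sum (eq_bigr (fun=> #|B|)) // prod_nat_const mulnC; congr (_ * _).
  apply: eq_card => g; rewrite inE andb_idr // => /forests_onP[_ gP].
  apply/eqP/ffunP => v; rewrite ffunE; case: ifP => // vY.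
  by have := gP v; case: (g v) => // u; rewrite !inE vY.
rewrite big_mkcond [RHS]big_mkcond /=; apply: eq_bigr => f _.
have ->: \prod_(v in Y) w v (f v) = (Y \subset kids f).
  case: (boolP (Y \subset kids f)) => [/subsetP Yk | /subsetPn[v vY vk]].
    by rewrite big1 // => v /Yk; rewrite inE /w; case: (f v) => // u ->.
  rewrite (bigD1 v) //=; move: vk; rewrite inE /w; case: (f v) => // u.
  by move/negPf->.
suff ->: (f \in forests_on D B) && (kids f == Y)
       = (clear Y f \in forests_on (D :\: B) Y) && (Y \subset kids f).
  by case: (_ \in _) => //=; case: (_ \subset _).
apply/andP/andP => [[/forests_onP[/forestP[h hP] fP] /eqP kY]
  | [/forests_onP[/forestP[h hP] gP] /subsetP Yk]].
  split; last by rewrite kY.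
  apply/forests_onP; split.
    apply/forestP; exists h => v u; rewrite ffunE; case: ifP => // _; exact: hP.
  move=> v; rewrite ffunE -kY; case: ifP => vk; first by rewrite !inE in vk *; rewrite vk.
  by have := fP v; move: vk; rewrite !inE; case: (f v) => [u vk|_]; rewrite ?inE ?vk.
have fY v u : v \in Y -> f v = Some u -> u \in B.
  by move=> /Yk; rewrite inE => + fv; rewrite fv.
have fNY v : v \notin Y -> clear Y f v = f v by rewrite ffunE => /negPf->.
have NYP v u : v \notin Y -> f v = Some u ->
    [/\ v \in D, v \notin B, u \in D, u \notin B & h u < h v].
  move=> vY fv; have := gP v; rewrite fNY // fv !inE vY /=.
  move=> /andP[/andP[-> ->] /andP[-> ->]]; split=> //.
  by apply: hP; rewrite fNY.
split.
  apply/forests_onP; split.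
    (* The rank of [clear Y f] says nothing about the edges from [Y] to [B], so [B] is sent to 0 and
       everything else is moved above it. *)
    apply/forestP; exists (fun v => if v \in B then 0 else (h v).+1) => v u fv.
    have [vY | vY] := boolP (v \in Y).
      rewrite (fY v u) //; have := YD v vY; rewrite inE => /andP[/negPf-> _] //.
    by have [_ /negPf-> _ /negPf-> ] := NYP v u vY fv.
  move=> v; have [vY | vY] := boolP (v \in Y).
    have := Yk v vY; rewrite inE; case: (f v) => // u uB.
    by rewrite YD // (subsetP BD).
  case fv: (f v) => [u|].
    by have [vD vB uD _ _] := NYP v u vY fv; rewrite inE vB vD.
  by have := gP v; rewrite fNY // fv !inE vY.
apply/eqP/setP => v; have [vY | vY] := boolP (v \in Y); first exact: Yk.
rewrite inE; case fv: (f v) => [u|] //.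
by have [_ _ _ /negPf-> _] := NYP v u vY fv.
Qed.

(** The factor [#|D|] avoids the exponent [d - r - 1], which is negative when [B = D]. The induction
    removes the layer [B]. *)
Lemma card_forests_on D B : B \subset D -> 0 < #|D| ->
  #|D| * #|forests_on D B| = #|B| * #|D| ^ (#|D| - #|B|).
Proof.
have [m] := ubnP #|D|; elim: m D B => // m IHm D B ltD BD D0.
have [B0 | B0] := posnP #|B|.
  (* Without roots, following parents inside [D] would lower the rank forever, so there is no such
     forest. *)
  rewrite B0 mul0n; apply/eqP; rewrite muln_eq0 orbC cards_eq0.
  apply/orP; left; apply/eqP/setP => f; rewrite in_set0.
  apply/negP => /forests_onP[ff fP].
  have [v vD] := card_gt0P D0.
  have fin u : u \in D -> exists2 w, f u = Some w & w \in D.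
    move=> uD; have := fP u; rewrite (cards0_eq B0) setD0 uD.
    by case: (f u) => // w /= wD; exists w.
  have [h hP] := forestP f ff.
  have [k] := ubnP (h v); elim: k v vD => // k IHk v vD ltk.
  have [w fv wD] := fin v vD.
  by apply: (IHk w wD); apply: leq_trans (hP _ _ fv) _; rewrite -ltnS.
have cD : #|D :\: B| = #|D| - #|B| by rewrite cardsD (setIidPr BD).
rewrite forests_on_rec //.
have [DB0 | DB0] := posnP #|D :\: B|.
  have DB : D = B.
    apply/eqP; rewrite eqEsubset BD andbT -setD_eq0 -cards_eq0 DB0 //.
  rewrite (cards0_eq DB0) -DB subnn expn0 muln1.
  rewrite (big_pred1 set0) => [|Y]; last by rewrite subset0.
  rewrite cards0 expn0 mul1n.
  rewrite (_ : #|forests_on set0 set0| = 1) ?muln1 //; apply/eqP/cards1P.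
  exists [ffun=> None]; apply/setP => f; rewrite in_set1.
  apply/forests_onP/eqP => [[_ fP] | ->].
    apply/ffunP => v; rewrite ffunE; have := fP v; rewrite !inE andbF /=.
    by case: (f v) => //.
  split=> [|v]; last by rewrite ffunE !inE.
  by apply/forestP; exists (fun=> 0) => v w; rewrite ffunE.
have ltDB : #|D :\: B| < m.
  by rewrite cD (@leq_trans #|D|) // ltn_subrL B0 D0.
(* The extra factor [#|D :\: B|] puts each summand in the form required by the induction
   hypothesis. *)
apply/eqP; rewrite -(eqn_pmul2l DB0); apply/eqP.
rewrite mulnCA [X in _ * X]big_distrr /=.
transitivity (#|D| * (#|B| * \sum_(Y : {set V} | Y \subset D :\: B)
   #|Y| * #|B| ^ #|Y|.-1 * #|D :\: B| ^ (#|D :\: B| - #|Y|))).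
  congr (_ * _); rewrite big_distrr /=; apply: eq_bigr => Y YD.
  rewrite mulnCA IHm //; case: #|Y| => [|y]; first by rewrite !mul0n !muln0.
  by rewrite expnS -!mulnA [_ ^ y * _]mulnCA.
rewrite sum_subsets_binomial // cD subnKC ?subset_leq_card //.
rewrite -cD; case: #|D :\: B| DB0 => // d _; rewrite expnS.
by rewrite mulnCA [RHS]mulnCA [in RHS](mulnCA d.+1).
Qed.

(** Grouping by root set and multiplying by [#|V|] turns this into [sum_subsets_binomial] on the
    whole of [V], with [x = b]. *)
Lemma sum_forests (b : nat) : 0 < #|V| ->
  \sum_(f | forest f) b ^ #|root_set f|.-1 = (b + #|V|) ^ #|V|.-1.
Proof.
move=> V0; apply/eqP; rewrite -(eqn_pmul2l V0) -cardsT -sum_subsets_binomial ?cardsT //.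
rewrite (partition_big root_set (fun B => B \subset [set: V])) => [|f _]; last exact: subsetT.
rewrite big_distrr /=; apply/eqP/eq_bigr => B _.
have card_B : #|[set f | forest f && (root_set f == B)]| = #|forests_on setT B|.
  apply: eq_card => f; rewrite !inE; congr (_ && _).
  apply/eqP/forallP => [<- v | fP]; first by case fv: (f v); rewrite !inE fv.
  apply/setP => v; rewrite [LHS]inE; have := fP v; case: (f v) => [w|]; rewrite !inE !andbT.
    by move/negPf.
  by rewrite negbK.
rewrite (eq_bigr (fun=> b ^ #|B|.-1)) => [|f /andP[_ /eqP->]] //.
rewrite sum_nat_cond_const -/(#|_|) card_B mulnA.
by have := card_forests_on (subsetT B); rewrite cardsT => -> //; rewrite mulnAC.
Qed.

End ParentFunctions.

(** * Forests with a prescribed maximal decreasing set *)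

Section MaximalDecreasing.

Variable n : nat.
Implicit Types (f g : {ffun 'I_n -> option 'I_n}) (S : {set 'I_n}).

Definition incr_rel f : rel 'I_n := [rel v w | (f v == Some w) && (v < w)].

(** For a forest with one root this is [MD] of the tree, read upwards from the vertex
    ([MD_edges]). *)
Definition MD_fun f : {set 'I_n} :=
  [set v | [exists r, (f r == None) && connect (incr_rel f) v r]].

Lemma in_MD_fun f v :
  (v \in MD_fun f) = if f v is Some w then (v < w) && (w \in MD_fun f) else true.
Proof.
rewrite !inE; case fv: (f v) => [w|]; last first.
  by apply/existsP; exists v; rewrite fv eqxx connect0.
apply/existsP/andP => [[r /andP[/eqP fr /connectP[[|u p] /=]]] | [vw]].
- by move=> _ rv; rewrite rv fv in fr.
- move=> /andP[/andP[/eqP + vu] pP] rE; rewrite fv => -[wu]; rewrite wu; split=> //.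
  by rewrite inE; apply/existsP; exists r; rewrite fr eqxx; apply/connectP; exists p.
- rewrite inE => /existsP[r /andP[fr wr]]; exists r; rewrite fr /=.
  by apply: connect_trans wr; apply: connect1; rewrite /incr_rel /= fv eqxx.
Qed.

(** The recursion of [in_MD_fun] has a unique solution, since it only passes to larger labels; this
    makes the condition local at each vertex. *)
Lemma eq_MD_fun f S :
  (MD_fun f == S)
  = [forall v, (v \in S) == if f v is Some w then (v < w) && (w \in S) else true].
Proof.
apply/eqP/forallP => [<- v | SP]; first by rewrite -in_MD_fun.
apply/setP => v; have [m] := ubnP (n - v); elim: m v => // m IHm v ltm.
rewrite in_MD_fun (eqP (SP v)); case: (f v) => // w.
case: (ltnP v w) => //= vw; apply: IHm.
by rewrite -ltnS; apply: leq_trans ltm; rewrite ltnS ltn_sub2l // ltn_ord.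
Qed.

Definition larger S (s : 'I_n) : {set 'I_n} := [set t in S | s < t].

(** As [s] runs through [S], the number of larger elements takes each value below [#|S|] once; the
    induction removes the minimum. *)
Lemma prod_larger S (c : nat -> nat) :
  \prod_(s in S) c #|larger S s| = \prod_(j < #|S|) c j.
Proof.
have [m] := ubnP #|S|; elim: m S => // m IHm S ltm.
have [->|[s0 s0S]] := set_0Vmem S; first by rewrite cards0 big_set0 big_ord0.
have [s sS s_min] : exists2 s, s \in S & forall t, t \in S -> s <= t.
  by case: (arg_minnP (fun s : 'I_n => s : nat) s0S) => s; exists s.
rewrite (big_setD1 s) //= (cardsD1 s S) sS big_ord_recr /= mulnC -IHm; last first.
  by move: ltm; rewrite (cardsD1 s S) sS.
congr (_ * c _).
  apply: eq_bigr => t /setD1P[ts tS]; congr (c _); apply: eq_card => u.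
  rewrite !inE; case: eqP => //= ->.
  by rewrite ltnNge s_min // andbF.
apply: eq_card => u; rewrite !inE andbC; case uS: (u \in S) => //=; rewrite ?andbF ?andbT //.
by rewrite ltn_neqAle s_min // andbT eq_sym -val_eqE.
Qed.

(** The factor [j = 0] is that of the largest vertex, which must be a root and carries no weight;
    the others give [(b + 1)...(b + k) = (k + b)! / b!]. *)
Lemma prod_shift (b k : nat) :
  \prod_(j < k.+1) ((if j == 0 :> nat then 1 else b) + j) = 'C(k + b, b) * k`!.
Proof.
apply/eqP; rewrite -(eqn_pmul2r (fact_gt0 b)) -mulnA [k`! * _]mulnC.
have := bin_fact (leq_addl k b); rewrite addnK => ->.
apply/eqP; elim: k => [|k IHk]; first by rewrite big_ord1 /= mul1n.
by rewrite big_ord_recr /= mulnAC IHk addSn factS mulnC addnC addSn.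
Qed.

(* What [MD_fun f = S] and [forest f] require of [g = clear S f]. *)
Definition outer_forest S g : bool :=
  forest g && [forall v, (v \notin S) ==>
    if g v is Some w then (w \in S) ==> (w <= v) else false].

(** The number of outer forests does not involve [b], so the values at two different [b] can be
    compared. *)
Lemma sum_forests_MD S (b : nat) : 0 < #|S| ->
  \sum_(f | forest f && (MD_fun f == S)) b ^ #|root_set f|.-1
  = #|[set g | outer_forest S g && (clear S g == g)]|
    * ('C(#|S|.-1 + b, b) * #|S|.-1`!).
Proof.
move=> S0.
(* A forbidden parent has weight 0, an allowed one 1, and becoming a root costs [b], except for the
   largest element of [S]. That exception accounts for the [.-1] in the exponent. *)
pose w (s : 'I_n) (x : option 'I_n) : nat :=
  if x is Some t then t \in larger S s else if #|larger S s| == 0 then 1 else b.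
have prodw : \prod_(s in S) \sum_x w s x = 'C(#|S|.-1 + b, b) * #|S|.-1`!.
  rewrite -prod_shift prednK // -(prod_larger S (fun j => (if j == 0 then 1 else b) + j)).
  apply: eq_bigr => s _.
  rewrite sum_option /=; congr (_ + _); rewrite -sum1_card [RHS]big_mkcond.
  by apply: eq_bigr => t _; case: ifP.
rewrite -prodw -(split_sum S (outer_forest S) w) big_mkcond [RHS]big_mkcond /=.
apply: eq_bigr => f _.
pose P := [forall s, (s \in S) ==> if f s is Some t then t \in larger S s else true].
have -> : forest f && (MD_fun f == S) = outer_forest S (clear S f) && P.
  rewrite eq_MD_fun; apply/andP/andP => [[/forestP[h hP] /forallP SP]
    | [/andP[/forestP[h hP] /forallP gP] /forallP fP]].
    split; last first.
      apply/forallP => s; apply/implyP => sS; have := SP s; rewrite sS.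
      by case: (f s) => // t; rewrite !inE andbC; case: (_ && _).
    apply/andP; split.
      by apply/forestP; exists h => v u; rewrite ffunE; case: ifP => // _; apply: hP.
    apply/forallP => v; apply/implyP => vS; rewrite ffunE (negPf vS).
    have := SP v; rewrite (negPf vS); case: (f v) => // u.
    by case: (u \in S); rewrite ?andbF ?andbT // (leqNgt u v); case: (v < u).
  have fS s t : s \in S -> f s = Some t -> (t \in S) && (s < t).
    by move=> sS fs; have := fP s; rewrite sS fs inE.
  split.
    (* Labels increase along parents inside [S], so [n - v] is a rank there. Outside, [h] is shifted
       above all these values, which also handles edges entering [S]. *)
    apply/forestP; exists (fun v => if v \in S then n - v else n.+1 + h v) => v u fv.
    have [vS | vS] := boolP (v \in S).
      by have /andP[-> vu] := fS v u vS fv; rewrite ltn_sub2l // ltn_ord.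
    case: ifP => _; first by rewrite addSn ltnS (leq_trans (leq_subr _ _)) ?leq_addr.
    by rewrite ltn_add2l hP // ffunE (negPf vS).
  apply/forallP => v; have [vS | vS] := boolP (v \in S).
    by case fv: (f v) => [u|] //; rewrite andbC (fS v u).
  have := gP v; rewrite vS ffunE (negPf vS) /=; case: (f v) => // u.
  by case: (u \in S); rewrite ?andbF //= (leqNgt u v) andbT => /negPf->.
case: (boolP (outer_forest S (clear S f))) => [/andP[_ /forallP gP]|//] /=.
case: (boolP P) => [/forallP fP | /forallPn[s]]; last first.
  rewrite negb_imply => /andP[sS fs]; rewrite (bigD1 s) //= /w.
  by move: fs; case: (f s) => // t /negPf->.
have [s0 s0S] := card_gt0P S0.
have [m mS m_max] : exists2 m, m \in S & forall t, t \in S -> t <= m.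
  by case: (arg_maxnP (fun s : 'I_n => s : nat) s0S) => m; exists m.
have larger0 s : s \in S -> (#|larger S s| == 0) = (s == m).
  move=> sS; rewrite cards_eq0; apply/eqP/eqP => [/setP/(_ m) | ->].
    rewrite !inE mS /= => /negbT; rewrite -leqNgt => ms.
    by apply/val_inj/eqP; rewrite eqn_leq ms m_max.
  apply/setP => t; rewrite !inE; apply/negP => /andP[tS].
  by rewrite ltnNge m_max.
(* Every root ends a trivial increasing path, hence lies in [S]; the maximum [m] of [S] has no
   admissible parent, hence is a root. *)
have rootS : root_set f \subset S.
  apply/subsetP => v; rewrite inE => /eqP fv; apply/negP => /negP vS.
  by have := gP v; rewrite vS ffunE (negPf vS) fv.
have rm : m \in root_set f.
  have := fP m; rewrite mS inE; case: (f m) => // t tm.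
  have : larger S m == set0 by rewrite -cards_eq0 larger0.
  by move/eqP => e; rewrite e inE in tm.
(* Each root other than [m] contributes [b] to the product, and every other vertex of [S]
   contributes 1. *)
rewrite (cardsD1 m) rm /= (bigID (fun s => s \in root_set f :\ m)) /=.
rewrite [X in _ * X]big1 ?muln1 => [|s /andP[sS]].
  rewrite -prod_nat_const; apply: eq_big => s.
    by rewrite andb_idl // => /setD1P[_]; apply: (subsetP rootS).
  rewrite !inE => /andP[sm /eqP fs]; rewrite fs /= larger0 ?(negPf sm) //.
  by apply: (subsetP rootS); rewrite inE fs.
rewrite !inE negb_and negbK /w => fs; have := fP s; rewrite sS /=.
move: fs; case: (f s) => [t _ -> //|]; rewrite orbF larger0 // => -> //.
Qed.

End MaximalDecreasing.

(** * Trees as edge sets versus parent functions with one root *)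

Section Trees.

Variable V : finType.
Implicit Types (f g : {ffun V -> option V}) (E : {set {set V}}).

Definition edges f : {set {set V}} :=
  [set e | [exists v, exists w, (f v == Some w) && (e == [set v; w])]].

Lemma adj_edges f x y : adj (edges f) x y = (f x == Some y) || (f y == Some x).
Proof.
rewrite /adj /= inE; apply/existsP/orP => [[v /existsP[w /andP[/eqP fv /eqP/setP exy]]]|].
  have := exy v; have := exy w; have := exy x; have := exy y.
  rewrite !inE !eqxx !orbT /= => /esym/orP yE /esym/orP xE /orP wE /orP vE.
  have [[-> ->] | [-> ->]] : (x = v /\ y = w) \/ (x = w /\ y = v).
    by case: yE xE wE vE => /eqP yE []/eqP xE []/eqP wE []/eqP vE;
       first [left; split; congruence | right; split; congruence].
    by left; rewrite fv.
  by right; rewrite fv.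
by case=> fxy; [exists x; apply/existsP; exists y | exists y; apply/existsP; exists x];
   rewrite fxy // setUC eqxx.
Qed.

Lemma adj_sym E : symmetric (adj E).
Proof. by move=> x y; rewrite /adj /= setUC. Qed.

Lemma forest_irr f v : forest f -> f v != Some v.
Proof. by case/forestP=> h hP; apply/eqP => /hP; rewrite ltnn. Qed.

Lemma edges_connected f r : forest f -> root_set f = [set r] -> connected (edges f).
Proof.
move=> /forestP[h hP] fr.
have to_r v : connect (adj (edges f)) v r.
  have [m] := ubnP (h v); elim: m v => // m IHm v ltm.
  case fv: (f v) => [w|].
    apply: connect_trans (IHm w _); last first.
      by rewrite -ltnS; apply: leq_trans ltm; rewrite ltnS hP.
    by apply: connect1; rewrite adj_edges fv eqxx.
  have : v \in root_set f by rewrite inE fv.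
  by rewrite fr inE => /eqP->.
apply/forallP => x; apply/forallP => y; apply: connect_trans (to_r x) _.
by rewrite (sym_connect_sym (@adj_sym _)).
Qed.

(* A vertex of maximal rank on a cycle would have two distinct parents. *)
Lemma edges_acyclic f : forest f -> acyclic (edges f).
Proof.
move=> /forestP[h hP]; apply/acyclicP => c cE; rewrite leqNgt; apply/negP => lt2c.
have [x0 x0c] : exists x0, x0 \in c
  by case: c lt2c {cE} => // x0 c _; exists x0; rewrite inE eqxx.
have [x xc x_max] : exists2 x, x \in c & forall y, y \in c -> h y <= h x.
  by case: (@arg_maxnP _ x0 (mem c) h x0c) => x; exists x.
have f_max y : y \in c -> adj (edges f) x y -> f x = Some y.
  move=> yc; rewrite adj_edges => /orP[/eqP // | /eqP /hP].
  by rewrite ltnNge x_max.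
(* After rotation the cycle starts at [x], with successor [y] and predecessor [z]. Both are the
   parent of [x], yet they are distinct because the cycle has more than two vertices. *)
have [i c' cE'] := rot_to xc.
have mem_c y : y \in x :: c' -> y \in c by rewrite -cE' mem_rot.
move: cE lt2c; rewrite -(rot_ucycle i) -(size_rot i c) cE' /ucycle.
case: c' mem_c {cE'} => [|y p] mem_c; first by rewrite andbC.
case/lastP: p mem_c => [|p z] mem_c; first by rewrite andbC.
rewrite /= rcons_path last_rcons => /andP[/and3P[xy _ zx] /and3P[_ yp _]] _.
have fy : f x = Some y by apply: f_max xy; rewrite mem_c // !inE eqxx orbT.
have fz : f x = Some z.
  by apply: f_max; rewrite 1?adj_sym // mem_c // !inE mem_rcons inE eqxx !orbT.
by move: yp; rewrite mem_rcons inE; move: fz; rewrite fy => -[->]; rewrite eqxx.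
Qed.

Lemma edges_tree f r : forest f -> root_set f = [set r] -> is_tree (edges f).
Proof.
move=> ff fr; apply/and3P; split; [|exact: edges_connected fr|exact: edges_acyclic].
apply/forall_inP => e; rewrite inE => /existsP[v /existsP[w /andP[fv /eqP->]]].
rewrite cards2; case: (eqVneq v w) fv => // <- fv.
by have := forest_irr v ff; rewrite fv.
Qed.

(** Induction on the rank for [f]: an edge from [v] to its parent [w] that [g] orients the other way
    would give [f w = Some v] by induction, against the rank. *)
Lemma edges_inj f g : forest f -> root_set f = root_set g -> edges f = edges g -> f = g.
Proof.
move=> /forestP[h hP] eqr eqE; apply/ffunP => v.
have [m] := ubnP (h v); elim: m v => // m IHm v ltm.
case fv: (f v) => [w|]; last first.
  have : v \in root_set f by rewrite inE fv.
  by rewrite eqr inE => /eqP.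
have wv := hP _ _ fv.
have : adj (edges g) v w by rewrite -eqE adj_edges fv eqxx.
rewrite adj_edges => /orP[/eqP // | /eqP gw].
have fw : f w = Some v by rewrite IHm // -ltnS; apply: leq_trans ltm; rewrite ltnS.
by have := hP _ _ fw; rewrite ltnNge ltnW.
Qed.

(** Each vertex other than [r] takes as parent a neighbour closer to [r]. Acyclicity of [E] ensures
    that no edge is left out. *)
Lemma edges_surj E r : is_tree E ->
  exists f, [/\ forest f, root_set f = [set r] & edges f = E].
Proof.
case/and3P => /forall_inP sE /forallP cE /acyclicP aE.
pose P v k := [exists p : k.-tuple V, path (adj E) r p && (last r p == v)].
have Pp v p : path (adj E) r p -> last r p = v -> P v (size p).
  by move=> pP <-; apply/existsP; exists (in_tuple p); rewrite pP eqxx.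
have exP v : exists k, P v k.
  have /forallP/(_ v)/connectP[p pP ->] := cE r.
  by exists (size p); apply: Pp.
(* [h v] is the distance from [r] to [v] in [E], which serves as the rank. *)
pose h v := ex_minn (exP v).
have stepP v : v != r -> exists w, adj E v w && (h w < h v).
  move=> vr; rewrite {2}/h; case: ex_minnP => k /existsP[[p /= /eqP <-]].
  case/lastP: p => [|p u] /andP[]; first by move=> _ /= rv; rewrite eq_sym rv in vr.
  rewrite rcons_path last_rcons size_rcons => /andP[pP pu] /eqP <- _.
  exists (last r p); rewrite adj_sym pu ltnS /h; case: ex_minnP => k' _.
  by apply; apply: Pp.
pose f : {ffun V -> option V} :=
  [ffun v => if v == r then None else [pick w | adj E v w && (h w < h v)]].
have fP v w : f v = Some w -> adj E v w && (h w < h v).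
  by rewrite ffunE; case: eqP => // _; case: pickP => // u uP [<-].
have ff : forest f by apply/forestP; exists h => v w /fP /andP[].
have fr : root_set f = [set r].
  apply/setP => v; rewrite !inE ffunE; case: (eqVneq v r) => [|/stepP[w wP]]; first by rewrite eqxx.
  by case: pickP => // /(_ w); rewrite wP.
exists f; split=> //.
have sub x y : adj (edges f) x y -> adj E x y.
  by rewrite adj_edges => /orP[]/eqP/fP/andP[] //; rewrite adj_sym.
have sup x y : adj E x y -> adj (edges f) x y.
  move=> xy; have xNy : x != y.
    by apply: contraTneq xy => ->; apply/negP => /sE; rewrite setUid cards1.
  have /forallP/(_ x)/forallP/(_ y)/connectP[p0 p0P yE] := edges_connected ff fr.
  case/shortenP: p0P yE => p pP pU _ yE.
  (* Otherwise the edge [xy] closes this path into a cycle. *)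
  have szp : size (x :: p) <= 2.
    apply: aE; rewrite /ucycle pU andbT /= rcons_path -yE adj_sym xy andbT.
    by apply: sub_path pP.
  case: p pP yE szp {pU} => [|u [|//]] /=; first by move=> _ yx; rewrite yx eqxx in xNy.
  by rewrite andbT => + ->.
have pairs E1 E2 : (forall e, e \in E1 -> #|e| == 2) ->
    (forall x y, adj E1 x y -> adj E2 x y) -> E1 \subset E2.
  move=> s1 a12; apply/subsetP => e eE.
  by have /cards2P[x [y [_ exy]]] := s1 e eE; rewrite exy in eE *; apply: a12.
apply/eqP; rewrite eqEsubset !pairs //.
by have /and3P[/forall_inP] := edges_tree ff fr.
Qed.

End Trees.

(** * Counting rooted trees through parent functions *)

Section Counting.

Variable n : nat.
Implicit Types (f g : {ffun 'I_n.+1 -> option 'I_n.+1}).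

(** On a decreasing walk from the root every step goes from parent to child: a step from [t] up to
    its parent would need a smaller parent, while [t] in [MD_fun f] has a larger one. *)
Lemma MD_edges f r : root_set f = [set r] -> MD (edges f, r) = MD_fun f.
Proof.
move=> fr; have rP v : (f v == None) = (v == r) by have/setP/(_ v) := fr; rewrite !inE.
apply/setP => v; apply/idP/idP.
  rewrite inE => /connectP[p]; elim/last_ind: p v => [|p u IHp] v.
    by move=> _ ->; rewrite in_MD_fun; have := rP r; rewrite eqxx => /eqP->.
  rewrite rcons_path last_rcons => /andP[pP /andP[]] /=; set t := last r p.
  rewrite adj_edges => tu ut ->.
  have tMD : t \in MD_fun f by apply: IHp.
  case/orP: tu => /eqP ft; last by rewrite in_MD_fun ft ut.
  by move: tMD; rewrite in_MD_fun ft ltnNge ltnW.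
have [m] := ubnP (n.+1 - v); elim: m v => // m IHm v ltm.
rewrite in_MD_fun; case fv: (f v) => [w|]; last first.
  by have := rP v; rewrite fv eqxx => /esym/eqP-> _; rewrite inE connect0.
case/andP=> vw wMD; rewrite inE; apply: (@connect_trans _ _ w).
  have : w \in MD (edges f, r).
    apply: IHm => //; rewrite -ltnS; apply: leq_trans ltm.
    by rewrite ltnS ltn_sub2l // ltn_ord.
  by rewrite inE.
by apply: connect1; rewrite /decr_adj /= vw andbT adj_edges fv eqxx orbT.
Qed.

Lemma card_rooted_trees_MD k :
  #|rooted_trees_MD n k|
  = #|[set f : {ffun 'I_n.+1 -> option 'I_n.+1} |
       [&& forest f, #|root_set f| == 1 & #|MD_fun f| == k.+1]]|.
Proof.
(* The default [ord0] is never reached for the one-root forests considered here. *)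
pose root f := odflt ord0 [pick r in root_set f].
have rootP f : #|root_set f| == 1 -> root_set f = [set root f].
  move=> /cards1P[r fr]; rewrite /root fr; case: pickP => [s|/(_ r)].
    by rewrite inE => /eqP->.
  by rewrite inE eqxx.
rewrite -(@card_in_imset _ _ (fun f => (edges f, root f) : rooted_graph n)).
  apply: eq_card => -[E r]; apply/idP/imsetP => [|[f]].
    rewrite !inE /= => /andP[tE MDk].
    have [f [ff fr eE]] := edges_surj r tE.
    have f1 : #|root_set f| == 1 by rewrite fr cards1.
    have rE : root f = r by apply: set1_inj; rewrite -rootP.
    exists f; last by rewrite eE rE.
    by rewrite inE ff f1 -(MD_edges fr) eE.
  rewrite inE => /and3P[ff /rootP fr MDk] ->.
  by rewrite !inE /= (edges_tree ff fr) (MD_edges fr).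
move=> f g; rewrite !inE => /and3P[ff /rootP fr _] /and3P[_ /rootP gr _] [eE rE].
by apply: edges_inj => //; rewrite fr gr rE.
Qed.

End Counting.

Theorem theorem3p3 (n alpha : nat) :
  \sum_(0 <= k < n.+1) 'C(k + alpha, alpha) * #|rooted_trees_MD n k|
  = (n + 1 + alpha) ^ n.
Proof.
have V0 : 0 < #|'I_n.+1| by rewrite card_ord.
pose F (b : nat) (f : {ffun 'I_n.+1 -> option 'I_n.+1}) := b ^ #|root_set f|.-1.
have MD0 f : forest f -> 0 < #|@MD_fun n.+1 f|.
  move=> ff; have /card_gt0P[r] := root_set_gt0 ord0 ff; rewrite inE => /eqP fr.
  by apply/card_gt0P; exists r; rewrite in_MD_fun fr.
transitivity (\sum_(f | forest f) 'C(#|@MD_fun n.+1 f|.-1 + alpha, alpha) * F 0 f).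
  rewrite big_mkord (partition_big (fun f => inord #|MD_fun f|.-1 : 'I_n.+1) xpredT) //=.
  apply: eq_bigr => k _; rewrite card_rooted_trees_MD -sum1_card big_distrr /=.
  rewrite big_mkcond [RHS]big_mkcond; apply: eq_bigr => f _; rewrite inE.
  case: (boolP (forest f)) => //= ff.
  have MDn : #|MD_fun f|.-1 < n.+1.
    by rewrite prednK ?MD0 //; have := max_card (mem (MD_fun f)); rewrite card_ord.
  rewrite -val_eqE /= inordK // -{1}(prednK (MD0 f ff)) eqSS /F.
  case: (_.-1 =P _) => [<- | _]; rewrite ?andbT ?andbF //.
  (* As a forest has a root and [0 ^ 0 = 1], [F 0] is the indicator of forests with exactly one
     root. *)
  by case: #|root_set f| (root_set_gt0 ord0 ff) => [|[|r]] // _; rewrite /= ?expn0 ?exp0n ?muln0.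
rewrite (partition_big (@MD_fun n.+1) (fun S => 0 < #|S|) MD0) /=.
transitivity (\sum_(f | forest f) F alpha f); last first.
  by rewrite sum_forests // card_ord addnC addn1.
rewrite [RHS](partition_big (@MD_fun n.+1) (fun S => 0 < #|S|) MD0) /=.
apply: eq_bigr => S S0.
rewrite (eq_bigr (fun f => 'C(#|S|.-1 + alpha, alpha) * F 0 f)); last first.
  by move=> f /andP[_ /eqP->].
(* At [b = 0] the binomial of [sum_forests_MD] is 1, so the explicit coefficient supplies exactly
   the one that appears at [b = alpha]. *)
by rewrite -big_distrr /= !sum_forests_MD // addn0 bin0 mul1n mulnCA.
Qed.
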